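(* Let $T\colon X\to X$ be an operator and let $\mathcal{F}$ be a family. Suppose there exist dense subsets $X_0,Y_0$ of $X$ and a sequence $(S_n)_{n\in\mathbb{N}_0}$ of maps from $Y_0$ into $X$ such that for all $x_0\in X_0$ and $y_0\in Y_0$, \[ \mathcal{F}\text{-}\lim_{n\to\infty}\bigl(T^nx_0,\ S_ny_0,\ T^nS_ny_0\bigr)=(0,0,y_0) \] in $X\times X\times X$. Then $T$ is $\mathcal{F}$-mixing.
   Context: $\mathbb{N}_0$ is the set of non-negative integers. An operator $T\colon X\to X$ is a continuous linear self-map of an infinite-dimensional separable Fréchet space $X$ over $\mathbb{R}$ or $\mathbb{C}$. A (Furstenberg) family is a collection $\mathcal{F}$ of subsets of $\mathbb{N}_0$ that is hereditary upward ($A\in\mathcal{F}$, $A\subset B\subset\mathbb{N}_0$ imply $B\in\mathcal{F}$), with the conventions $\mathcal{F}\ne\emptyset$ and $\emptyset\notin\mathcal{F}$. For a sequence $(z_n)_{n\in\mathbb{N}_0}$ in a metric space $Z$ and $z\in Z$, $\mathcal{F}\text{-}\lim_{n\to\infty}z_n=z$ means that $\{n\in\mathbb{N}_0: z_n\in U\}\in\mathcal{F}$ for every neighborhood $U$ of $z$. For $U,V\subset X$, $N_T(U,V)=\{n\in\mathbb{N}_0: T^nU\cap V\ne\emptyset\}$. $T$ is $\mathcal{F}$-transitive if $N_T(U,V)\in\mathcal{F}$ for all non-empty open $U,V\subset X$, and $\mathcal{F}$-mixing if $T\oplus T$ on $X\oplus X$ is $\mathcal{F}$-transitive. *)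

(* Defs.v *)
From HB Require Import structures.
From mathcomp Require Import all_boot all_order all_algebra.
From mathcomp Require Import complex.
From mathcomp Require Import all_classical all_reals all_analysis.
Import numFieldNormedType.Exports.

Set Implicit Arguments.
Unset Strict Implicit.
Unset Printing Implicit Defensive.

Import Order.TTheory GRing.Theory Num.Theory.

Local Open Scope classical_set_scope.
Local Open Scope ring_scope.

Variant scalar_kind := real_scalars | complex_scalars.

Definition scalars (R : realType) (k : scalar_kind) : numFieldType :=
  match k with
  | real_scalars => R
  | complex_scalars => R[i]
  end.

(* [tvsType] includes local convexity.  Completeness is expressed with the
   invariant metric because the uniformity carried by a [tvsType] is only
   required to induce the topology, not to be translation invariant. *)
Definition frechet_space (R : realType) (K : numFieldType) (X : tvsType K) :=
  exists d : X -> X -> R,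
    [/\ [/\ forall x y, 0 <= d x y,
            forall x y, d x y = 0 <-> x = y,
            forall x y, d x y = d y x &
            forall x y z, d x z <= d x y + d y z],
        forall x y z, d (x + z) (y + z) = d x y,
        forall (x : X) (U : set X),
          nbhs x U <-> exists2 e : R, 0 < e & [set y | d x y < e] `<=` U &
        forall u : nat -> X,
          (forall e : R, 0 < e -> exists N : nat, forall m n : nat,
             (N <= m)%N -> (N <= n)%N -> d (u m) (u n) < e) ->
          exists l : X, u @ \oo --> l].

Definition separable (X : topologicalType) :=
  exists2 D : set X, countable D & dense D.

Definition infinite_dimensional (K : numFieldType) (X : lmodType K) :=
  forall (n : nat) (v : 'I_n -> X),
    ~ forall x : X, exists c : 'I_n -> K, x = \sum_(i < n) c i *: v i.

Definition furstenberg_family (F : set (set nat)) :=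
  [/\ F !=set0, ~ F set0 & forall A B : set nat, F A -> A `<=` B -> F B].

Definition family_lim (F : set (set nat)) (Z : topologicalType)
    (u : nat -> Z) (z : Z) :=
  forall U : set Z, nbhs z U -> F [set n | U (u n)].

Definition return_times (X : Type) (T : X -> X) (U V : set X) : set nat :=
  [set n | (iter n T @` U) `&` V !=set0].

Definition family_transitive (F : set (set nat)) (X : topologicalType)
    (T : X -> X) :=
  forall U V : set X, open U -> open V -> U !=set0 -> V !=set0 ->
    F (return_times T U V).

Definition direct_sum (X Y : Type) (T : X -> X) (S : Y -> Y) : X * Y -> X * Y :=
  fun z => (T z.1, S z.2).

Definition family_mixing (F : set (set nat)) (X : topologicalType)
    (T : X -> X) :=
  family_transitive F (direct_sum T T).

(* Main.v *)
(* For a 0-neighbourhood W, the criterion applied to one pair (x0, y0) yields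
   that N(U, W) /\ N(W, V) is in F.  If u in U is sent into W and w in W into V,
   then u + w travels from near U to near V; hence T is F-transitive.  As F need
   not be a filter, two pairs (U1, V1) and (U2, V2) cannot be treated separately.
   Instead, transitivity gives p and q such that U1 /\ T^-p U2 and V1 /\ T^-q V2
   are non-empty.  One pair taken from these two sets, with W shrunk to
   W /\ T^-p W /\ T^-q W, then handles (U1, V1) and (U2, V2) at the same times n,
   because T^n commutes with T^p and T^q. *)
Require Import Defs.
From HB Require Import structures.
From mathcomp Require Import all_boot all_order all_algebra.
From mathcomp Require Import all_classical all_reals all_analysis.
Import numFieldNormedType.Exports.
Import Order.TTheory GRing.Theory Num.Theory.

Local Open Scope classical_set_scope.
Local Open Scope ring_scope.

Lemma iter_comm (X : Type) (T : X -> X) (m n : nat) (x : X) :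
  iter m T (iter n T x) = iter n T (iter m T x).
Proof. by rewrite -!iterD addnC. Qed.

Lemma iter_continuous (X : topologicalType) (T : X -> X) (n : nat) :
  continuous T -> continuous (iter n T).
Proof.
move=> Tc; elim: n => [|n IH] x; first exact: cvg_id.
by apply: (@continuous_comp _ _ _ (iter n T) T); [exact: IH|exact: Tc].
Qed.

Lemma iter_additive (V : zmodType) (T : {additive V -> V}) (n : nat) :
  {morph iter n T : x y / x + y}.
Proof. by move=> x y; elim: n => //= n ->; rewrite raddfD. Qed.

Lemma iter_additive0 (V : zmodType) (T : {additive V -> V}) (n : nat) :
  iter n T 0 = 0.
Proof. by elim: n => //= n ->; rewrite raddf0. Qed.

Lemma iter_direct_sum (X Y : Type) (T : X -> X) (S : Y -> Y) (n : nat) z :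
  iter n (direct_sum T S) z = (iter n T z.1, iter n S z.2).
Proof. by elim: n => [|n /= ->] //; case: z. Qed.

(** Continuity of addition at [(u, 0)], with [u] in [U]. The set [W] is the room left for an error
    term [w]. *)
Lemma open_add_nbhs0 (K : numDomainType) (X : tvsType K) (U : set X) :
  open U -> U !=set0 ->
  exists A W : set X, [/\ open A, A !=set0, nbhs 0 W &
    forall a w, A a -> W w -> U (a + w)].
Proof.
move=> oU [u Uu].
have : nbhs (u + 0) U by rewrite addr0; exact: open_nbhs_nbhs.
move=> /(@add_continuous X (u, 0)) [[A W] /= [nA nW] AW].
exists A°, W; split=> //; first exact: open_interior.
  by exists u; exact: nA.
by move=> a w /interior_subset Aa Ww; apply: (AW (a, w)).
Qed.

Lemma open_prod_rect (X Y : topologicalType) (U : set (X * Y)) :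
  open U -> U !=set0 ->
  exists (A : set X) (B : set Y),
    [/\ open A, A !=set0, open B, B !=set0 & A `*` B `<=` U].
Proof.
move=> oU [[x y] Uxy].
have [[A B] /= [nA nB] AB] : nbhs (x, y) U by exact: open_nbhs_nbhs.
exists A°, B°; split;
  [exact: open_interior|by exists x|exact: open_interior|by exists y|].
by move=> z [/interior_subset ? /interior_subset ?]; exact: AB.
Qed.

(** The two conditions share only the time [n]: the point going from [U] to [W] and the one going
    from [W] to [V] may be unrelated. *)
Definition return_through {X : Type} (T : X -> X) (U W V : set X) : set nat :=
  return_times T U W `&` return_times T W V.

Lemma criterion_return_through (X : topologicalType) (o : X) (T : X -> X)
    (F : set (set nat)) (X0 Y0 : set X) (S : nat -> Y0 -> X) (U W V : set X) :
  furstenberg_family F -> dense X0 -> dense Y0 ->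
  (forall (x0 : X) (y0 : Y0), X0 x0 ->
    family_lim F (fun n => (iter n T x0, S n y0, iter n T (S n y0)))
      (o, o, set_val y0)) ->
  open U -> U !=set0 -> nbhs o W -> open V -> V !=set0 ->
  F (return_through T U W V).
Proof.
move=> [_ _ Fup] dX dY limS oU U0 nW oV V0.
have [x [Ux Xx]] := dX U U0 oU.
have [y [Vy Yy]] := dY V V0 oV.
have yY : y \in Y0 by exact/mem_set.
have nWWV : nbhs (o, o, set_val (exist _ y yY : Y0)) (W `*` W `*` V).
  exists (W `*` W, V) => //=; split; last exact: open_nbhs_nbhs.
  by exists (W, W).
(* At such [n], [x] witnesses the passage from [U] to [W], and [S n y] the passage from [W] to
   [V]. *)
apply: Fup (limS x (exist _ y yY) Xx _ nWWV) _ => n /= [[Wx Ws] Vs].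
by split; [exists (iter n T x); split=> //; exists x|
  exists (iter n T (S n (exist _ y yY))); split=> //; exists (S n (exist _ y yY))].
Qed.

Lemma return_through_transitive (K : numDomainType) (X : tvsType K)
    (T : {additive X -> X}) (F : set (set nat)) :
  furstenberg_family F ->
  (forall U W V : set X, open U -> U !=set0 -> nbhs 0 W ->
    open V -> V !=set0 -> F (return_through T U W V)) ->
  family_transitive F T.
Proof.
move=> [_ _ Fup] FT U V oU oV U0 V0.
have [A [W [oA A0 nW AWU]]] := open_add_nbhs0 _ _ _ oU U0.
have [B [W' [oB B0 nW' BWV]]] := open_add_nbhs0 _ _ _ oV V0.
apply: Fup (FT A (W `&` W') B oA A0 (filterI nW nW') oB B0) _ => n.
move=> [[_ [[a Aa <-] [_ W'a]]] [_ [[w [Ww _] <-] Bw]]].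
(* At time 0, [w] is a small error added to [a]; at time [n] the roles are exchanged, and
   [iter n T a] is a small error added to [iter n T w]. *)
exists (iter n T (a + w)); split; first by exists (a + w) => //; exact: AWU.
by rewrite iter_additive addrC; exact: BWV.
Qed.

Lemma return_through_mixing (K : numDomainType) (X : tvsType K)
    (T : {additive X -> X}) (F : set (set nat)) :
  continuous T -> furstenberg_family F ->
  (forall U W V : set X, open U -> U !=set0 -> nbhs 0 W ->
    open V -> V !=set0 -> F (return_through T U W V)) ->
  family_mixing F T.
Proof.
move=> Tc Ff FT; have [_ nF0 Fup] := Ff.
have nbhs_preim m (W : set X) : nbhs 0 W -> nbhs 0 (iter m T @^-1` W).
  by move=> nW; apply: iter_continuous => //; rewrite iter_additive0.
have meet (A B : set X) : open A -> A !=set0 -> open B -> B !=set0 ->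
    exists m, open (A `&` iter m T @^-1` B) /\ A `&` iter m T @^-1` B !=set0.
  move=> oA A0 oB B0.
  have FAB := return_through_transitive _ _ _ _ Ff FT A B oA oB A0 B0.
  (* A member of [F] is non-empty, so some return time exists. *)
  have [m [_ [[a Aa <-] Ba]]] : return_times T A B !=set0.
    by apply/set0P/eqP => AB0; rewrite AB0 in FAB.
  exists m; split; last by exists a.
  apply: openI => //; apply: open_comp => // x _; exact: iter_continuous.
move=> U V oU oV U0 V0.
have [U1 [U2 [oU1 U10 oU2 U20 UU]]] := open_prod_rect _ _ _ oU U0.
have [V1 [V2 [oV1 V10 oV2 V20 VV]]] := open_prod_rect _ _ _ oV V0.
have [A1 [W1 [oA1 A10 nW1 AW1]]] := open_add_nbhs0 _ _ _ oU1 U10.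
have [A2 [W2 [oA2 A20 nW2 AW2]]] := open_add_nbhs0 _ _ _ oU2 U20.
have [B1 [W3 [oB1 B10 nW3 BW1]]] := open_add_nbhs0 _ _ _ oV1 V10.
have [B2 [W4 [oB2 B20 nW4 BW2]]] := open_add_nbhs0 _ _ _ oV2 V20.
have [p [oA A0]] := meet A1 A2 oA1 A10 oA2 A20.
have [q [oB B0]] := meet B1 B2 oB1 B10 oB2 B20.
(* [W1] and [W2] absorb the errors [w] and [iter q T w] at the start; [W3] and [W4] absorb
   [iter n T a] and [iter p T (iter n T a)] at time [n]. *)
pose W := (W1 `&` W3) `&` (iter q T @^-1` W2 `&` iter p T @^-1` W4).
have nW : nbhs 0 W by do 2 apply: filterI; auto.
apply: Fup (FT _ W _ oA A0 nW oB B0) _ => n.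
move=> [[_ [[a [A1a A2a] <-] [[_ W3a] [_ W4a]]]]].
move=> [_ [[w [[W1w _] [W2w _]] <-] [B1w B2w]]].
rewrite /= in A2a W4a W2w B2w.
rewrite iter_comm in W4a; rewrite iter_comm in B2w.
(* The second coordinate moves [a] by [p] steps into [A2], but [w] by [q] steps, so that after [n]
   more steps the latter lands in [B2]. *)
exists (iter n (direct_sum T T) (a + w, iter p T a + iter q T w)); split.
  by exists (a + w, iter p T a + iter q T w) => //; apply: UU; split;
    [exact: AW1|exact: AW2].
rewrite iter_direct_sum; apply: VV; split => /=.
  by rewrite iter_additive addrC; exact: BW1.
by rewrite iter_additive addrC; exact: BW2.
Qed.

Theorem theorem3p9 (R : realType) (k : scalar_kind)
    (X : tvsType (scalars R k)) (Xfrechet : frechet_space R X)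
    (Xsep : separable X) (Xinf : infinite_dimensional X)
    (T : {linear X -> X}) (Tcont : continuous T)
    (F : set (set nat)) (Ffam : furstenberg_family F)
    (X0 Y0 : set X) (X0dense : dense X0) (Y0dense : dense Y0)
    (S : nat -> Y0 -> X)
    (limS : forall (x0 : X) (y0 : Y0), X0 x0 ->
      family_lim F
        (fun n => (iter n T x0, S n y0, iter n T (S n y0)))
        (0, 0, set_val y0)) :
  family_mixing F T.
Proof.
apply: return_through_mixing => // U W V *.
exact: (criterion_return_through _ 0 _ _ _ _ _ _ _ _ Ffam X0dense Y0dense limS).
Qed.
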